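(* Let $p,q,r$ be real numbers with $p,q,r>1$ and $p+q+r>4$. Then \[ \sum_{n=1}^\infty \left(\zeta(p)-\sum_{i=1}^n\frac1{i^p}\right) \left(\zeta(q)-\sum_{j=1}^n \frac1{j^q}\right) \left(\zeta(r)-\sum_{k=1}^n \frac1{k^r}\right) \] equals \begin{multline*} \zeta(p,q,r-1)+\zeta(p,r,q-1)+\zeta(q,p,r-1)+\zeta(q,r,p-1)+\zeta(r,p,q-1) +\zeta(r,q,p-1)\\+\zeta(p+q,r-1)+\zeta(p+r,q-1)+\zeta(q+r,p-1)+\zeta(p,q+r-1) +\zeta(q,p+r-1)+\zeta(r,p+q-1)\\+\zeta(p+q+r-1)-\zeta(p)\zeta(q)\zeta(r) . \end{multline*}
   Context: $\zeta$ denotes the Riemann zeta function. For real numbers $a_1,\dots,a_m$ the multiple zeta value is $\zeta(a_1,\dots,a_m)=\sum_{n_1>n_2>\dots>n_m\ge 1} n_1^{-a_1}\cdots n_m^{-a_m}$ (convergent when $a_1+\dots+a_j>j$ for $j=1,\dots,m$). *)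

(* Defs.v *)
From HB Require Import structures.
From mathcomp Require Import all_boot all_order all_algebra.
From mathcomp Require Import all_classical all_reals all_analysis.

Set Implicit Arguments.
Unset Strict Implicit.
Unset Printing Implicit Defensive.

Import Order.TTheory GRing.Theory Num.Theory.
Import numFieldNormedType.Exports.

Local Open Scope classical_set_scope.
Local Open Scope ring_scope.

(* Only meant for s > 1, where the series converges.  The index of [riemannR]
   is shifted by one: [riemannR s n] is 1 / (n + 1)^s. *)
Definition zeta (R : realType) (s : R) : R := limn (series (riemannR s)).

Definition mzv_index (m : nat) : set (m.-tuple nat) :=
  [set n : m.-tuple nat | sorted gtn n /\ all (leq 1) n].
Arguments mzv_index m : clear implicits.

(* The terms are nonnegative, so the multiple series is the unordered sum
   [esum], which is +oo when the series diverges; [fine] maps that case to the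
   junk value 0. *)
Definition mzv (R : realType) (m : nat) (a : m.-tuple R) : R :=
  fine (\esum_(n in mzv_index m)
          (\prod_(i < m) (tnth n i)%:R `^ (- tnth a i))%:E)%E.

(* Main.v *)
Require Import Defs.
From HB Require Import structures.
From mathcomp Require Import all_boot all_order all_algebra.
From mathcomp Require Import all_classical all_reals all_analysis.
From mathcomp Require Import zify ring lra.
Import Order.TTheory GRing.Theory Num.Theory.
Import numFieldNormedType.Exports.
Local Open Scope classical_set_scope.
Local Open Scope ring_scope.

(* The n-th factor zeta(a) - sum_(i <= n) i^-a is the tail sum_(i > n) i^-a, so
   summing the products of the three tails over n >= 0 counts each triple
   (i, j, k) min(i, j, k) times; the term n = 0 is zeta(p) zeta(q) zeta(r).
   Hence the left-hand side plus that product is the sum over i, j, k >= 1 of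
   min(i, j, k) i^-p j^-q k^-r.  Splitting it according to the 13 possible
   relative orders of i, j, k, the factor min(i, j, k) lowers the exponent of
   the smallest variable by one, and each order gives one (multiple) zeta
   value. *)

Set Implicit Arguments.
Unset Strict Implicit.
Unset Printing Implicit Defensive.

(** * Unordered sums: scaling, products, layers, partitions *)

Section esum_complements.
Local Open Scope ereal_scope.
Context {R : realType}.

Lemma esumZl (T : choiceType) (A : set T) (c : R) (f : T -> \bar R) :
  (0 <= c)%R -> (forall t, 0 <= f t) ->
  \esum_(t in A) (c%:E * f t) = c%:E * \esum_(t in A) f t.
Proof.
have le_esumZl (x : R) g : (0 <= x)%R -> (forall t, 0 <= g t) ->
    \esum_(t in A) (x%:E * g t) <= x%:E * \esum_(t in A) g t.
  move=> x0 g0; apply: ge_ereal_sup => _ [X AX <-].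
  rewrite -ge0_mule_fsumr//; apply: lee_pmul => //; first by apply: fsume_ge0.
  by apply: ereal_sup_ubound; exists X.
move=> c0 f0; apply/eqP; rewrite eq_le le_esumZl//=.
have [->|c_neq0] := eqVneq c 0%R.
  by rewrite mul0e; apply: esum_ge0 => t _; rewrite mul0e.
(* The reverse inequality is [le_esumZl] for [c^-1] and the family [c * f]. *)
have : \esum_(t in A) (c^-1%:E * (c%:E * f t)) <=
    c^-1%:E * \esum_(t in A) (c%:E * f t).
  by apply: le_esumZl; rewrite ?invr_ge0// => t; rewrite mule_ge0.
under eq_esum do rewrite muleA -EFinM mulVf// mul1e.
by rewrite -lee_pdivlMl ?invr_gt0 ?lt_def ?c_neq0// invrK.
Qed.

Lemma esumM (T1 T2 : choiceType) (A : set T1) (B : set T2)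
    (f : T1 -> R) (g : T2 -> R) (x y : R) :
  (forall t, 0 <= f t)%R -> (forall t, 0 <= g t)%R ->
  \esum_(t in A) (f t)%:E = x%:E -> \esum_(t in B) (g t)%:E = y%:E ->
  \esum_(t in A `*` B) (f t.1 * g t.2)%:E = (x * y)%:E.
Proof.
move=> f0 g0 fx gy; have y0 : (0 <= y)%R.
  by rewrite -lee_fin -gy; apply: esum_ge0 => t _; rewrite lee_fin.
have -> : A `*` B = A `*`` (fun=> B) by [].
rewrite -(@esum_esum _ _ _ A (fun=> B) (fun s t => (f s * g t)%:E)); last first.
  by move=> s t _ _; rewrite lee_fin mulr_ge0.
under eq_esum => s _.
  under eq_esum => t _ do rewrite EFinM.
  rewrite esumZl// gy muleC.
  over.
by rewrite esumZl// fx -EFinM mulrC.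
Qed.

(** Layer-cake formula: [m t] counts the n below [m t]; the two sums are then exchanged. *)
Lemma esum_layers (T : choiceType) (m : T -> nat) (f : T -> R) :
  (forall t, 0 <= f t)%R ->
  \esum_(t in [set t | (0 < m t)%N]) ((m t)%:R * f t)%:E =
  \esum_(n in [set: nat]) \esum_(t in [set t | (n < m t)%N]) (f t)%:E.
Proof.
move=> f0; under eq_esum => t _.
  rewrite mulr_natl (_ : (f t *+ m t)%:E = \esum_(n in `I_(m t)) (f t)%:E).
    over.
  rewrite esum_fset//; first by rewrite -fsbig_ord/= sumEFin sumr_const card_ord.
  by move=> n _; rewrite lee_fin.
rewrite esum_esum; last by move=> *; rewrite lee_fin.
rewrite esum_esum; last by move=> *; rewrite lee_fin.
apply: (@reindex_esum _ _ _ _ _ (fun k => (k.2, k.1))).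
split.
- by move=> [n t] /= [_ nt]; split => //; exact: leq_ltn_trans nt.
- by move=> [n t] [n' t'] _ _ /= [-> ->].
- by move=> [t n] /= [_ nt]; exists (n, t).
Qed.

(** The hypothesis on [count] makes [Ps] a partition of [D]: exactly one predicate holds on [D],
    none outside. *)
Lemma esum_count (T : choiceType) (D : pred T) (Ps : seq (pred T)) (f : T -> \bar R) :
  (forall t, 0 <= f t) -> (forall t, count (fun P => P t) Ps = D t) ->
  \esum_(t in [set t | D t]) f t = \sum_(P <- Ps) \esum_(t in [set t | P t]) f t.
Proof.
move=> f0 DE; under eq_bigr do rewrite esum_mkcond.
rewrite -esum_sum; last by move=> *; case: ifP.
rewrite esum_mkcond; apply: eq_esum => t _.
under eq_bigr do rewrite mem_setE.
rewrite -big_mkcond/= big_const_seq DE.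
by rewrite mem_setE unfold_in; case: (D t); rewrite //= addr0.
Qed.

Lemma subset_le_esum (T : choiceType) (A B : set T) (f : T -> \bar R) :
  A `<=` B -> \esum_(t in A) f t <= \esum_(t in B) f t.
Proof.
move=> AB; apply: ge_ereal_sup => _ [X [finX XA] <-].
by apply: ereal_sup_ubound; exists X => //; split => //; exact: subset_trans AB.
Qed.

End esum_complements.

(** * Convergence of the zeta series and its tails *)

Section zeta_tails.
Context {R : realType}.
Implicit Types (a : R) (n : nat).

Lemma riemannR_ge0 a n : 0 <= riemannR a n.
Proof. by rewrite invr_ge0 powR_ge0. Qed.

(* Both (2k)^-a and (2k + 1)^-a are at most 2^-a k^-a, so that the partial
   sums s_n satisfy s_n <= s_(2n+1) <= 1 + 2^(1-a) s_n. *)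
Lemma riemannR_series_le a n : 1 < a ->
  series (riemannR a) n <= (1 - 2 * 2 `^ (- a))^-1.
Proof.
move=> a1; set c := 2 `^ (- a).
have c_lt : 2 * c < 1.
  rewrite /c powRN -(mulr_powRB1 _ (lt_trans ltr01 a1)) ?ler0n//.
  rewrite invfM mulVKf// invf_lt1 ?powR_gt0//.
  have : 1 `^ (a - 1) < 2 `^ (a - 1).
    by rewrite gt0_ltr_powR ?subr_gt0 ?nnegrE ?ltr1n.
  by rewrite powR1.
have half i j : (2 * i.+1 <= j.+1)%N -> riemannR a j <= c * riemannR a i.
  move=> ij; rewrite /riemannR /c -!powRN -powRM ?ler0n//.
  rewrite !powRN lef_pV2 ?posrE ?powR_gt0// ?mulr_gt0//.
  by rewrite ge0_ler_powR ?nnegrE ?mulr_ge0 ?(ltW (lt_trans _ a1))// -natrM ler_nat.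
have double k : series (riemannR a) k.*2.+1 <=
    1 + 2 * c * series (riemannR a) k.
  elim: k => [|k IHk].
    by rewrite /series/= big_nat1 big_geq// mulr0 addr0 /riemannR powR1 invr1.
  (* Passing from k to k + 1 adds the terms of the integers 2k + 2 and 2k + 3, both at least 2 (k +
     1). *)
  have u1 : riemannR a k.*2.+1 <= c * riemannR a k by apply: half; lia.
  have u2 : riemannR a k.*2.+2 <= c * riemannR a k by apply: half; lia.
  by rewrite seriesS in IHk; rewrite doubleS !seriesS mulrDr; lra.
set s := series _ n; have s_le : s <= 1 + 2 * c * s.
  apply: le_trans (double n); apply: nondecreasing_series => //.
    by move=> k _ _; exact: riemannR_ge0.
  by rewrite -addnn; lia.
by rewrite -[X in _ <= X]mul1r ler_pdivlMr ?subr_gt0//; lra.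
Qed.

Lemma cvg_riemannR a : 1 < a -> series (riemannR a) @ \oo --> zeta a.
Proof.
move=> a1; apply: nondecreasing_is_cvgn.
  by apply: nondecreasing_series => n _ _; exact: riemannR_ge0.
by exists (1 - 2 * 2 `^ (- a))^-1 => _ [n _ <-]; exact: riemannR_series_le.
Qed.

(** The substitution i = k + n + 1 turns the tail into the [riemannR] series from index n on, that
    is, zeta minus its first n terms. *)
Lemma zeta_tail a n : 1 < a ->
  (\esum_(i in [set i | (n < i)%N]) (i%:R `^ (- a))%:E)%E =
  (zeta a - \sum_(1 <= i < n.+1) 1 / (i%:R `^ a))%:E.
Proof.
move=> a1; pose f k := (riemannR a k)%:E.
have f0 k : (0 <= f k)%E by rewrite lee_fin riemannR_ge0.
rewrite (@reindex_esum _ _ _ setT _ (fun k => (k + n).+1)); last first.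
  split.
  - by move=> k _ /=; lia.
  - by move=> k l _ _ /=; lia.
  - by move=> k /= nk; exists (k - n.+1)%N => //; lia.
transitivity (\esum_(k in setT) f (k + n)%N)%E.
  by apply: eq_esum => k _; rewrite /f /riemannR powRN.
rewrite -nneseries_esumT// nneseries_addn//.
have : (\sum_(0 <= k <oo) f k = (zeta a)%:E)%E.
  rewrite -(cvg_lim _ (cvg_riemannR a1))// -EFin_lim; last first.
    by apply/cvg_ex; exists (zeta a); exact: cvg_riemannR.
  by apply: congr_lim; apply/funext => m /=; rewrite sumEFin.
rewrite (nneseries_split 0 n)// add0n sumEFin EFinB => <-.
have -> : \sum_(1 <= i < n.+1) 1 / (i%:R `^ a) = \sum_(0 <= k < n) riemannR a k.
  by rewrite big_add1/=; apply: eq_bigr => i _; rewrite div1r.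
by rewrite [in RHS]addeAC subee ?add0e.
Qed.

End zeta_tails.

(** * Multiple zeta values over other index sets *)

Section mzv_reindexing.
Context {R : realType}.

(** [e] and [g] are inverse bijections between [D] and [mzv_index m]. Finiteness is asked because
    [fine] in [mzv] would turn +oo into 0. *)
Lemma esum_mzv (T : choiceType) m (a : m.-tuple R) (D : set T) (f : T -> R)
    (e : T -> m.-tuple nat) (g : m.-tuple nat -> T) :
  (forall t, D t -> mzv_index m (e t) /\ g (e t) = t) ->
  (forall n, mzv_index m n -> D (g n) /\ e (g n) = n) ->
  (forall t, D t -> f t = \prod_(i < m) (tnth (e t) i)%:R `^ (- tnth a i)) ->
  (\esum_(t in D) (f t)%:E \is a fin_num)%E ->
  (\esum_(t in D) (f t)%:E = (mzv a)%:E)%E.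
Proof.
move=> De eD fE fin; rewrite /mzv (@reindex_esum _ _ _ D _ e).
  under [X in _ = (fine X)%:E]eq_esum => t Dt do rewrite -fE//.
  by rewrite fineK.
split.
- by move=> t /De[].
- by move=> t u; rewrite !inE => /De[_ {2}<-] /De[_ {2}<-] ->.
- by move=> n /eD[Dgn egn]; exists (g n).
Qed.

Definition decr2 i j := [&& 0 < j & j < i]%N.
Definition decr3 i j k := [&& 0 < k, k < j & j < i]%N.

(** [x] and [y] read the larger and the smaller index off t and [g] rebuilds t, so that t may be a
    triple with two equal coordinates. *)
Lemma esum_mzv2 (T : choiceType) (a b : R) (D : pred T) (f : T -> R)
    (x y : T -> nat) (g : nat -> nat -> T) :
  (forall t, D t -> decr2 (x t) (y t) /\ g (x t) (y t) = t) ->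
  (forall i j, decr2 i j -> [/\ D (g i j), x (g i j) = i & y (g i j) = j]) ->
  (forall t, D t -> f t = (x t)%:R `^ (- a) * (y t)%:R `^ (- b)) ->
  (\esum_(t in [set t | D t]) (f t)%:E \is a fin_num)%E ->
  (\esum_(t in [set t | D t]) (f t)%:E = (mzv [tuple a; b])%:E)%E.
Proof.
move=> Dx gD fE.
apply: (esum_mzv (e := fun t => [tuple x t; y t])
  (g := fun n => g (tnth n ord0) (tnth n (lift ord0 ord0)))).
- move=> t /= /Dx[/andP[y0 yx] gE]; split => //.
  by rewrite /mzv_index/= y0 yx (ltn_trans y0 yx).
- move=> n; case/tupleP: n => i n; case/tupleP: n => j n; rewrite (tuple0 n).
  rewrite /mzv_index /= => -[/andP[ji _] /and3P[i0 j0 _]].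
  have [|? xE yE] := gD i j; first exact/andP.
  split => //; apply: val_inj => /=; congr [:: _; _] => //.
- by move=> t /fE ->; rewrite !big_ord_recl big_ord0 mulr1.
Qed.

Lemma esum_mzv3 (T : choiceType) (a b c : R) (D : pred T) (f : T -> R)
    (x y z : T -> nat) (g : nat -> nat -> nat -> T) :
  (forall t, D t -> decr3 (x t) (y t) (z t) /\ g (x t) (y t) (z t) = t) ->
  (forall i j k, decr3 i j k ->
    [/\ D (g i j k), x (g i j k) = i, y (g i j k) = j & z (g i j k) = k]) ->
  (forall t, D t ->
    f t = (x t)%:R `^ (- a) * (y t)%:R `^ (- b) * (z t)%:R `^ (- c)) ->
  (\esum_(t in [set t | D t]) (f t)%:E \is a fin_num)%E ->
  (\esum_(t in [set t | D t]) (f t)%:E = (mzv [tuple a; b; c])%:E)%E.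
Proof.
move=> Dx gD fE.
apply: (esum_mzv (e := fun t => [tuple x t; y t; z t])
  (g := fun n => g (tnth n ord0) (tnth n (lift ord0 ord0))
    (tnth n (lift ord0 (lift ord0 ord0))))).
- move=> t /= /Dx[/and3P[z0 zy yx] gE]; split => //.
  have y0 := ltn_trans z0 zy.
  by rewrite /mzv_index/= z0 zy yx y0 (ltn_trans y0 yx).
- move=> n; case/tupleP: n => i n; case/tupleP: n => j n; case/tupleP: n => k n.
  rewrite (tuple0 n) /mzv_index /= => -[/and3P[ji kj _] /and4P[i0 j0 k0 _]].
  have [|? xE yE zE] := gD i j k; first exact/and3P.
  split => //; apply: val_inj => /=; congr [:: _; _; _] => //.
- by move=> t /fE ->; rewrite !big_ord_recl big_ord0 mulr1 mulrA.
Qed.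

End mzv_reindexing.

(** * The sum weighted by min(i, j, k) *)

Section min_weight.
Context {R : realType}.
Implicit Types (a b p q r : R) (n : nat) (t : nat * nat * nat).

Lemma powR_natND a b n : (0 < n)%N ->
  n%:R `^ (- (a + b)) = n%:R `^ (- a) * n%:R `^ (- b).
Proof. by move=> n0; rewrite opprD powRD// pnatr_eq0 -lt0n n0 implybT. Qed.

Lemma powR_natNB1 a n : (0 < n)%N ->
  n%:R `^ (- (a - 1)) = n%:R * n%:R `^ (- a).
Proof. by move=> n0; rewrite powR_natND// opprK powRr1// mulrC. Qed.

Definition min3 t := minn (minn t.1.1 t.1.2) t.2.

Definition powR3 p q r t :=
  t.1.1%:R `^ (- p) * t.1.2%:R `^ (- q) * t.2%:R `^ (- r).

Lemma powR3_ge0 p q r t : 0 <= powR3 p q r t.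
Proof. by rewrite !mulr_ge0 ?powR_ge0. Qed.

(** A minimum above n means that all three coordinates exceed n: the index set is a cube and the sum
    a product of three tails. *)
Lemma esum_powR3 p q r n : 1 < p -> 1 < q -> 1 < r ->
  (\esum_(t in [set t | (n < min3 t)%N]) (powR3 p q r t)%:E =
   ((zeta p - \sum_(1 <= i < n.+1) 1 / (i%:R `^ p)) *
    (zeta q - \sum_(1 <= j < n.+1) 1 / (j%:R `^ q)) *
    (zeta r - \sum_(1 <= k < n.+1) 1 / (k%:R `^ r)))%:E)%E.
Proof.
move=> p1 q1 r1; pose A := [set i | (n < i)%N].
have -> : [set t | (n < min3 t)%N] = A `*` A `*` A.
  by apply/seteqP; split => -[[i j] k]; rewrite /min3/A/=; lia.
have pow0 a (i : nat) : 0 <= i%:R `^ (- a) :> R by exact: powR_ge0.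
apply: (esumM (f := fun u => u.1%:R `^ (- p) * u.2%:R `^ (- q)) _ (pow0 r)).
- by move=> u; rewrite mulr_ge0.
- by apply: (esumM (pow0 p) (pow0 q)); exact: zeta_tail.
- exact: zeta_tail.
Qed.

(* Distributing min(i, j, k) <= i^u j^v k^w over the three factors, with
   u + v + w = 1 and u, v, w proportional to p - 1, q - 1, r - 1, keeps
   all three exponents p - u, q - v, r - w above 1. *)
Lemma esum_min3_lty p q r : 1 < p -> 1 < q -> 1 < r -> 4 < p + q + r ->
  (\esum_(t in [set t | (0 < min3 t)%N]) ((min3 t)%:R * powR3 p q r t)%:E
    < +oo)%E.
Proof.
(* [d] is the sum of p - 1, q - 1 and r - 1. The hypothesis p + q + r > 4 gives d > 1, so each
   weight (a - 1) / d is below a - 1. *)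
move=> p1 q1 r1 pqr; set d := p + q + r - 3.
have d1 : 1 < d by rewrite /d; lra.
have d0 : 0 < d := lt_trans ltr01 d1.
pose w a := (a - 1) / d.
have w0 a : 1 < a -> 0 <= w a.
  by move=> a1; rewrite divr_ge0// ?ltW// subr_gt0.
have w1 a : 1 < a -> 1 < a - w a.
  move=> a1; have : w a < a - 1; last by move=> ?; lra.
  by rewrite ltr_pdivrMr// ltr_pMr// subr_gt0.
have sum_w : w p + (w q + w r) = 1.
  by rewrite -!mulrDl (_ : p - 1 + (q - 1 + (r - 1)) = d) ?divff ?gt_eqF// /d; ring.
apply: (@le_lt_trans _ _ (\esum_(t in [set t | (0 < min3 t)%N])
    (powR3 (p - w p) (q - w q) (r - w r) t)%:E)%E); last first.
  (* The dominating sum is a product of three convergent zeta series. *)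
  by rewrite esum_powR3 ?w1// ltry.
apply: le_esum => -[[i j] k] m0; rewrite lee_fin /powR3 /=.
set m := min3 _ in m0 *.
have [mi mj mk] : [/\ m <= i, m <= j & m <= k]%N.
  by rewrite /m /min3 /=; split; lia.
have -> : m%:R = m%:R `^ w p * (m%:R `^ w q * m%:R `^ w r) :> R.
  by rewrite -!powRD ?sum_w ?powRr1// pnatr_eq0 -lt0n m0 implybT.
have shift a l : 1 < a -> (m <= l)%N ->
    m%:R `^ w a * l%:R `^ (- a) <= l%:R `^ (- (a - w a)).
  move=> a1 ml; rewrite powR_natND ?(leq_trans m0)// opprK mulrC.
  by rewrite ler_wpM2l ?powR_ge0// ge0_ler_powR ?w0// ?nnegrE ?ler_nat.
rewrite [leLHS](_ : _ = (m%:R `^ w p * i%:R `^ (- p)) *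
    (m%:R `^ w q * j%:R `^ (- q)) * (m%:R `^ w r * k%:R `^ (- r))); last by ring.
by rewrite !ler_pM ?mulr_ge0 ?powR_ge0// shift.
Qed.

End min_weight.

(** * The thirteen relative orders of i, j, k *)

(** Listed as the terms of the final formula: six strict orders, three with the two largest equal,
    three with the two smallest equal, the diagonal. *)
Definition order_types : seq (pred (nat * nat * nat)) :=
  [:: (fun '(i, j, k) => decr3 i j k); (fun '(i, j, k) => decr3 i k j);
      (fun '(i, j, k) => decr3 j i k); (fun '(i, j, k) => decr3 j k i);
      (fun '(i, j, k) => decr3 k i j); (fun '(i, j, k) => decr3 k j i);
      (fun '(i, j, k) => (i == j) && decr2 i k);
      (fun '(i, j, k) => (i == k) && decr2 i j);
      (fun '(i, j, k) => (j == k) && decr2 j i);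
      (fun '(i, j, k) => (j == k) && decr2 i j);
      (fun '(i, j, k) => (i == k) && decr2 j i);
      (fun '(i, j, k) => (i == j) && decr2 k i);
      (fun '(i, j, k) => [&& 0 < i, i == j & j == k]%N)].

Lemma order_typesP t : count (fun P => P t) order_types = (0 < min3 t)%N.
Proof.
case: t => [[i j] k]; rewrite /min3 /= /decr2 /decr3 !leq_min.
case: (ltngtP i j) => [ij|ij|<-]; case: (ltngtP _ k) => [jk|jk|<-];
  rewrite ?eqxx ?ltnn ?andbF ?andbT /=; try case: (ltngtP i k) => [ik|ik|<-];
  rewrite ?andbF ?andbT /=; lia.
Qed.

(** For the side conditions of [esum_mzv2] and [esum_mzv3]: finiteness, the two inversion
    conditions, the form of the summand. *)
Ltac order_type_goal :=
  lazymatch goal with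
  | |- is_true (_ \is a fin_num) =>
    match goal with fin : _ |- _ =>
      apply: fin => -[[i j] k]; rewrite /decr2 /decr3 /min3/=; lia
    end
  | |- forall t, _ -> _ /\ _ => move=> [[i j] k] //=; by case/andP=> /eqP <-
  | |- forall t, _ -> _ = _ =>
    move=> [[i j] k]; rewrite /decr2 /decr3 /powR3 /min3 /= => ?;
    match goal with |- context [minn (minn ?x ?y) ?z] =>
      first [rewrite (_ : minn (minn x y) z = z); last by lia
            |rewrite (_ : minn (minn x y) z = y); last by lia
            |rewrite (_ : minn (minn x y) z = x); last by lia]
    end;
    repeat match goal with H : is_true ((_ == _) && _) |- _ =>
      move: H => /andP[/eqP <-] ?
    end;
    (* [powR_natNB1] goes first, since [powR_natND] would also split a - 1. *)
    rewrite ?powR_natNB1 ?powR_natND; [ring|lia..]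
  | |- _ => by move=> * /=; rewrite ?eqxx
  end.

Lemma esum_min3 (R : realType) (p q r : R) :
  1 < p -> 1 < q -> 1 < r -> 4 < p + q + r ->
  (\esum_(t in [set t | (0 < min3 t)%N]) ((min3 t)%:R * powR3 p q r t)%:E =
  (mzv [tuple p; q; r - 1] + mzv [tuple p; r; q - 1] +
  mzv [tuple q; p; r - 1] + mzv [tuple q; r; p - 1] +
  mzv [tuple r; p; q - 1] + mzv [tuple r; q; p - 1] +
  mzv [tuple p + q; r - 1] + mzv [tuple p + r; q - 1] +
  mzv [tuple q + r; p - 1] + mzv [tuple p; q + r - 1] +
  mzv [tuple q; p + r - 1] + mzv [tuple r; p + q - 1] +
  zeta (p + q + r - 1))%:E)%E.
Proof.
move=> p1 q1 r1 pqr; pose G t := (min3 t)%:R * powR3 p q r t.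
have G0 t : (0 <= (G t)%:E)%E by rewrite lee_fin mulr_ge0// powR3_ge0.
(* Each order lies within the positive triples, so its sum is finite; hence every multiple zeta
   value below converges. *)
have fin (P : pred (nat * nat * nat)) : (forall t, P t -> 0 < min3 t)%N ->
    (\esum_(t in [set t | P t]) (G t)%:E \is a fin_num)%E.
  move=> P0; rewrite ge0_fin_numE; last exact: esum_ge0.
  by apply: le_lt_trans (esum_min3_lty p1 q1 r1 pqr); exact: subset_le_esum.
rewrite (esum_count _ order_typesP)// !big_cons big_nil addr0.
(* In each call [x], [y], [z] give the coordinates in decreasing order; the exponent of the last one
   drops by one. *)
rewrite (esum_mzv3 (a := p) (b := q) (c := r - 1) (x := fun t => t.1.1)
  (y := fun t => t.1.2) (z := fun t => t.2) (g := fun x y z => (x, y, z)));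
  try order_type_goal.
rewrite (esum_mzv3 (a := p) (b := r) (c := q - 1) (x := fun t => t.1.1)
  (y := fun t => t.2) (z := fun t => t.1.2) (g := fun x y z => (x, z, y)));
  try order_type_goal.
rewrite (esum_mzv3 (a := q) (b := p) (c := r - 1) (x := fun t => t.1.2)
  (y := fun t => t.1.1) (z := fun t => t.2) (g := fun x y z => (y, x, z)));
  try order_type_goal.
rewrite (esum_mzv3 (a := q) (b := r) (c := p - 1) (x := fun t => t.1.2)
  (y := fun t => t.2) (z := fun t => t.1.1) (g := fun x y z => (z, x, y)));
  try order_type_goal.
rewrite (esum_mzv3 (a := r) (b := p) (c := q - 1) (x := fun t => t.2)
  (y := fun t => t.1.1) (z := fun t => t.1.2) (g := fun x y z => (y, z, x)));
  try order_type_goal.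
rewrite (esum_mzv3 (a := r) (b := q) (c := p - 1) (x := fun t => t.2)
  (y := fun t => t.1.2) (z := fun t => t.1.1) (g := fun x y z => (z, y, x)));
  try order_type_goal.
(* The two largest coordinates agree: their exponents add. *)
rewrite (esum_mzv2 (a := p + q) (b := r - 1) (x := fun t => t.1.1) (y := fun t => t.2)
  (g := fun x y => (x, x, y))); try order_type_goal.
rewrite (esum_mzv2 (a := p + r) (b := q - 1) (x := fun t => t.1.1) (y := fun t => t.1.2)
  (g := fun x y => (x, y, x))); try order_type_goal.
rewrite (esum_mzv2 (a := q + r) (b := p - 1) (x := fun t => t.1.2) (y := fun t => t.1.1)
  (g := fun x y => (y, x, x))); try order_type_goal.
(* The two smallest agree: their exponents add, then drop by one. *)
rewrite (esum_mzv2 (a := p) (b := q + r - 1) (x := fun t => t.1.1) (y := fun t => t.1.2)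
  (g := fun x y => (x, y, y))); try order_type_goal.
rewrite (esum_mzv2 (a := q) (b := p + r - 1) (x := fun t => t.1.2) (y := fun t => t.1.1)
  (g := fun x y => (y, x, y))); try order_type_goal.
rewrite (esum_mzv2 (a := r) (b := p + q - 1) (x := fun t => t.2) (y := fun t => t.1.1)
  (g := fun x y => (y, y, x))); try order_type_goal.
rewrite (_ : (\esum_(t in _) _)%E = (zeta (p + q + r - 1))%:E).
  by rewrite -!EFinD !addrA.
(* The diagonal is a single series, the full zeta series read as the tail past 0. *)
rewrite (@reindex_esum _ _ _ [set i | (0 < i)%N] _ (fun i => (i, i, i))).
  transitivity (\esum_(i in [set i | (0 < i)%N])
      (i%:R `^ (- (p + q + r - 1)))%:E)%E.
    apply: eq_esum => i i0; rewrite /powR3 /min3 /= !minnn.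
    by rewrite powR_natNB1// !powR_natND.
  by rewrite zeta_tail ?big_geq ?subr0//; lra.
split.
- by move=> i /= ->; rewrite eqxx.
- by move=> i j _ _ [].
- by move=> [[i j] k] /= /and3P[i0 /eqP <- /eqP <-]; exists i.
Qed.

(** * Summation over n and passage to the limit *)

Theorem theorem6 (R : realType) (p q r : R)
    (hp : 1 < p) (hq : 1 < q) (hr : 1 < r) (hpqr : 4 < p + q + r) :
  (\sum_(1 <= n < N.+1)
      ((zeta p - \sum_(1 <= i < n.+1) 1 / (i%:R `^ p)) *
       (zeta q - \sum_(1 <= j < n.+1) 1 / (j%:R `^ q)) *
       (zeta r - \sum_(1 <= k < n.+1) 1 / (k%:R `^ r)))) @[N --> \oo] -->
  mzv [tuple p; q; r - 1] + mzv [tuple p; r; q - 1] +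
  mzv [tuple q; p; r - 1] + mzv [tuple q; r; p - 1] +
  mzv [tuple r; p; q - 1] + mzv [tuple r; q; p - 1] +
  mzv [tuple p + q; r - 1] + mzv [tuple p + r; q - 1] +
  mzv [tuple q + r; p - 1] + mzv [tuple p; q + r - 1] +
  mzv [tuple q; p + r - 1] + mzv [tuple r; p + q - 1] +
  zeta (p + q + r - 1) - zeta p * zeta q * zeta r.
Proof.
set S := (X in _ --> X - _).
pose u n := (zeta p - \sum_(1 <= i < n.+1) 1 / (i%:R `^ p)) *
  (zeta q - \sum_(1 <= j < n.+1) 1 / (j%:R `^ q)) *
  (zeta r - \sum_(1 <= k < n.+1) 1 / (k%:R `^ r)).
have u0 : u 0%N = zeta p * zeta q * zeta r by rewrite /u !big_geq// !subr0.
have uE n : (\esum_(t in [set t | (n < min3 t)%N]) (powR3 p q r t)%:E =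
    (u n)%:E)%E by exact: esum_powR3.
have u_ge0 n : 0 <= u n.
  by rewrite -lee_fin -uE; apply: esum_ge0 => t _; rewrite lee_fin powR3_ge0.
(* [u n] is the sum over the layer n < min(i, j, k), so the layers from n = 0 on add up to [S]. *)
have uS : (\sum_(0 <= n <oo) (u n)%:E = S%:E)%E.
  rewrite -(esum_min3 hp hq hr hpqr) esum_layers; last exact: powR3_ge0.
  by rewrite nneseries_esumT//; apply: eq_esum => n _; rewrite uE.
have /fine_cvg cvg_u : (\sum_(0 <= n < N) (u n)%:E)%E @[N --> \oo] --> S%:E.
  by rewrite -uS; apply: is_cvg_nneseries => n _ _; rewrite lee_fin.
have {}cvg_u : series u @ \oo --> S.
  apply: cvg_trans cvg_u; apply: near_eq_cvg; apply: nearW => N /=.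
  by rewrite sumEFin.
(* The sum in the theorem starts at n = 1: the partial sums are shifted to N + 1 terms and [u 0],
   the product of the zetas, is removed. *)
rewrite -cvg_shiftS in cvg_u.
have : series u n.+1 - u 0%N @[n --> \oo] --> S - u 0%N.
  by apply: cvgB => //; exact: cvg_cst.
rewrite u0; apply: cvg_trans; apply: near_eq_cvg; apply: nearW => N /=.
by rewrite /series/= big_nat_recl// -u0 addrC addKr big_add1.
Qed.
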